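(* Let $\lambda>0$ and $i\ge 1$ be an integer, and let $n_1,\dots,n_i$ be independent random variables, each Poisson distributed with parameter $\lambda$. Define the frequency $f_i=\sum_{j=1}^{i} n_j$, the persistence $p_i=\sum_{j=1}^{i}\mathbf{1}[n_j\ge 1]$, and, on the event $\{p_i\ge 1\}$, the density $d_i=f_i/p_i$. Then $$\mathbb{E}[f_i]=i\lambda,\qquad \mathbb{E}[p_i]=i\,(1-e^{-\lambda}),\qquad \mathbb{E}[d_i]=\frac{\lambda}{1-e^{-\lambda}},$$ $$\operatorname{Var}[f_i]=i\lambda,\qquad \operatorname{Var}[p_i]=i\,e^{-\lambda}(1-e^{-\lambda}),\qquad \operatorname{Var}[d_i]\le \frac{\lambda^2}{(1-e^{-\lambda})^2}+\frac{\lambda+\lambda^2}{1-e^{-\lambda}}<\infty,$$ where the expectation and variance of $d_i$ are taken conditionally on the event $\{p_i\ge 1\}$.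
   Context: Model of a single network flow observed over $i$ consecutive time windows: $n_j$ is the number of packets of the flow in the $j$-th window, assumed i.i.d. Poisson with a fixed parameter $\lambda>0$. Frequency is the total packet count, persistence is the number of windows in which the flow appears at least once, and density is frequency divided by persistence, defined only when persistence is positive. *)

(* Defs.v *)
From mathcomp Require Import all_boot all_order all_algebra.
From mathcomp Require Import all_classical all_reals all_analysis.

Set Implicit Arguments.
Unset Strict Implicit.
Unset Printing Implicit Defensive.

Import Order.TTheory GRing.Theory Num.Theory.

Local Open Scope classical_set_scope.
Local Open Scope ring_scope.
Local Open Scope ereal_scope.

Definition mutually_independent (d d' : measure_display) (T : measurableType d)
    (T' : measurableType d') (R : realType) (P : probability T R) (I : finType)
    (X : I -> {RV P >-> T'}) : Prop :=
  forall (J : {set I}) (B : I -> set T'), (forall j, measurable (B j)) ->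
    P (\bigcap_(j in [set` J]) X j @^-1` B j)
    = \prod_(j in J) P (X j @^-1` B j).

(* The second argument of [poisson_prob] is a dummy: its value does not depend
   on it. *)
Definition poisson_distributed (d : measure_display) (T : measurableType d)
    (R : realType) (P : probability T R) (rate : R) (X : {RV P >-> nat}) : Prop :=
  forall B : set nat, distribution P X B = poisson_prob rate 0%N B.

(* The conditional probability P(. | A). By convention of [mnormalize] it is P
   itself when P A = 0; see [cond_probE] for the case P A != 0. *)
Definition cond_prob (d : measure_display) (T : measurableType d)
    (R : realType) (P : probability T R) (A : set T) (mA : measurable A)
    : probability T R :=
  mnormalize (mrestr P mA) P.

Lemma cond_probE (d : measure_display) (T : measurableType d) (R : realType)
    (P : probability T R) (A : set T) (mA : measurable A) (U : set T) :
  P A != 0 -> cond_prob P mA U = P (U `&` A) * (fine (P A))^-1%:E.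
Proof.
move=> PA0; rewrite /cond_prob /= /mnormalize /=.
have E : mrestr P mA setT = P A by congr (P _); exact: setTI.
case: ifPn => [|_]; last by congr (_ * (fine _)^-1%:E).
rewrite -/(mrestr P mA setT) !E (negbTE PA0) /= => /eqP PAoo.
have : P A \is a fin_num by exact: fin_num_measure.
by rewrite PAoo.
Qed.

Section flow.
Context (d : measure_display) (T : measurableType d) (R : realType)
  (P : probability T R) (i : nat) (n : 'I_i -> {RV P >-> nat}).

Definition frequency (w : T) : nat := (\sum_(j < i) n j w)%N.

Definition persistence (w : T) : nat := (\sum_(j < i) (1 <= n j w))%N.

(* Meaningful only where the persistence is positive; elsewhere this is 0 / 0,
   which is 0 in a fieldType. *)
Definition density (w : T) : R :=
  ((frequency w)%:R / (persistence w)%:R)%R.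

Definition active : set T := [set w | (1 <= persistence w)%N].

Lemma measurable_active : measurable active.
Proof.
rewrite (_ : active = \bigcup_(j in [set: 'I_i]) n j @^-1` [set k | (1 <= k)%N]).
  by apply: fin_bigcup_measurable => // j _; exact: measurable_funPTI.
apply/seteqP; split => w.
  rewrite /active /persistence /= lt0n sum_nat_eq0 => /forallPn[j].
  by rewrite /= eqb0 negbK => nj; exists j.
move=> [j _ /= nj]; rewrite /active /persistence /= lt0n sum_nat_eq0.
by apply/forallPn; exists j; rewrite /= nj.
Qed.

Definition cond_active : probability T R := cond_prob P measurable_active.

End flow.

(* Main.v *)
(* On the event that the set of active windows equals a fixed nonempty S, the
   counts n_j with j in S are independent copies of a Poisson variable
   conditioned to be positive; hence, for g 0 = 0, the conditional mean of
   (\sum_j g (n_j)) / p_i is E[g (n_1)] / (1 - e^-lambda) whatever S is.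
   With g = id this is E[d_i]; with g = square it bounds E[d_i^2], because d_i^2
   is at most the mean of the n_j^2 over the active windows. *)
Require Import Defs.
From mathcomp Require Import all_boot all_order all_algebra.
From mathcomp Require Import all_classical all_reals all_analysis.
From mathcomp Require Import measurable_realfun.
From mathcomp Require Import ring.

Set Implicit Arguments.
Unset Strict Implicit.
Unset Printing Implicit Defensive.

Import Order.TTheory GRing.Theory Num.Theory.

Local Open Scope classical_set_scope.
Local Open Scope ring_scope.
Local Open Scope ereal_scope.

(** * Integrals of functions of a [nat]-valued random variable *)

Section nat_valued.
Context (d : measure_display) (T : measurableType d) (R : realType)
  (P : probability T R).
Implicit Types (X Y : {RV P >-> nat}) (A : set T) (g h : nat -> R).

Lemma integral_probability_cst (r : R) : \int[P]_w r%:E = r%:E.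
Proof. by have := expectation_cst P r; rewrite unlock. Qed.

Lemma measurable_preimage_nat X (U : set nat) : measurable (X @^-1` U).
Proof. exact: measurable_funPTI. Qed.

Lemma measurable_nat_comp X g : measurable_fun [set: T] (fun w => g (X w)).
Proof. by apply: (@measurableT_comp _ _ _ _ _ _ g _ X). Qed.

Lemma measurable_EFin_nat_comp X g A :
  measurable_fun A (EFin \o (fun w => g (X w))).
Proof.
by apply: measurable_funTS; apply/measurable_EFinP; exact: measurable_nat_comp.
Qed.

(** The fibres of [X] cut [A] into countably many disjoint pieces, over which a nonnegative integral
    is additive. *)
Lemma ge0_integral_fibers X A (f : T -> \bar R) : measurable A ->
    measurable_fun [set: T] f -> (forall w, 0 <= f w) ->
  \int[P]_(w in A) f w =
  \sum_(k <oo) \int[P]_(w in A `&` X @^-1` [set k]) f w.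
Proof.
move=> mA mf f0; rewrite -ge0_integral_bigcup //.
- congr (integral _ _ _); apply/seteqP; split=> [w Aw|w [k _ []]] //.
  by exists (X w).
- by move=> k; apply: measurableI => //; exact: measurable_preimage_nat.
- exact: measurable_funTS.
- apply/trivIsetP => k l _ _ kl; apply/seteqP; split=> // w.
  by move=> [[_ /= Xk] [_ /= Xl]]; move: kl; rewrite -Xk Xl eqxx.
Qed.

Lemma ge0_integral_nat X A g : measurable A -> (forall k, (0 <= g k)%R) ->
  \int[P]_(w in A) (g (X w))%:E =
  \sum_(k <oo) ((g k)%:E * P (A `&` X @^-1` [set k])).
Proof.
move=> mA g0; rewrite (ge0_integral_fibers X) //; last 2 first.
- exact: measurable_EFin_nat_comp.
- by move=> w; rewrite lee_fin.
apply: eq_eseriesr => k _.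
rewrite -integral_cst; last first.
  by apply: measurableI => //; exact: measurable_preimage_nat.
by apply: eq_integral => w /[!inE] -[_ /= ->].
Qed.

(** Independence of the point events suffices: summing over the fibres of [X] and then of [Y]
    factors the mean of the product. *)
Lemma ge0_integral_mul_indep X Y g h (a b : R) :
    (forall k l, P (X @^-1` [set k] `&` Y @^-1` [set l])
      = P (X @^-1` [set k]) * P (Y @^-1` [set l])) ->
    (forall k, (0 <= g k)%R) -> (forall k, (0 <= h k)%R) ->
    \int[P]_w (g (X w))%:E = a%:E -> \int[P]_w (h (Y w))%:E = b%:E ->
  \int[P]_w (g (X w) * h (Y w))%:E = (a * b)%:E.
Proof.
move=> XY g0 h0 Ea Eb.
have b0 : (0 <= b)%R.
  by rewrite -lee_fin -Eb; apply: integral_ge0 => w _; rewrite lee_fin.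
rewrite (ge0_integral_fibers X) //; last 2 first.
- apply/measurable_EFinP; apply: measurable_funM.
    exact: (measurable_nat_comp X g).
  exact: (measurable_nat_comp Y h).
- by move=> w; rewrite lee_fin mulr_ge0.
(* The factor [b] enters the series for the mean of [g (X w)]; both sides are then sums over the
   fibres of [X], compared term by term. *)
rewrite mulrC EFinM -Ea [in RHS]ge0_integral_nat // -nneseriesZl; last first.
  by move=> k _; rewrite mule_ge0 ?lee_fin.
apply: eq_eseriesr => k _; rewrite !setTI.
have mX := measurable_preimage_nat X [set k].
transitivity (\int[P]_(w in X @^-1` [set k]) ((g k)%:E * (h (Y w))%:E)).
  by apply: eq_integral => w /[!inE] /= ->; rewrite EFinM.
have hZ := ge0_integralZl P mX (@measurable_EFin_nat_comp Y h (X @^-1` [set k])).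
rewrite hZ //; last 2 first.
- by move=> w _; rewrite lee_fin.
- by rewrite lee_fin.
rewrite [RHS]muleCA -Eb; congr (_ * _).
rewrite [LHS]ge0_integral_nat // [in RHS]ge0_integral_nat //.
rewrite muleC -[P (X @^-1` _)]fineK ?fin_num_measure //.
rewrite -nneseriesZl; last by move=> l _; rewrite mule_ge0 ?lee_fin.
apply: eq_eseriesr => l _; rewrite fineK ?fin_num_measure //.
by rewrite setTI muleCA; congr (_ * _); rewrite -XY.
Qed.

End nat_valued.

(** * Moments of a Poisson variable *)

Section poisson.
Context (d : measure_display) (T : measurableType d) (R : realType)
  (P : probability T R) (lambda : R) (X : {RV P >-> nat}).
Hypotheses (lambda_gt0 : (0 < lambda)%R) (XP : poisson_distributed lambda X).

Lemma poisson_preimage1 k :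
  P (X @^-1` [set k]) = (lambda ^+ k * k`!%:R^-1 * expR (- lambda))%:E.
Proof.
have := XP [set k]; rewrite /distribution /pushforward => ->.
by rewrite /poisson_prob lambda_gt0 esum_set1 ?lee_fin ?poisson_pmf_ge0//
  /poisson_pmf lambda_gt0.
Qed.

(** The Stein-Chen identity: the term at [k = 0] vanishes, and [k] times the mass at [k] is [lambda]
    times the mass at [k - 1]. The choices [g = 1] and [g = id] give the first two moments. *)
Lemma poisson_shift (g : nat -> R) : (forall k, (0 <= g k)%R) ->
  \int[P]_w ((X w)%:R * g (X w))%:E = lambda%:E * \int[P]_w (g (X w).+1)%:E.
Proof.
move=> g0.
have ng0 k : (0 <= k%:R * g k)%R by rewrite mulr_ge0.
rewrite (@ge0_integral_nat _ _ _ _ X setT (fun k => k%:R * g k)%R) //.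
rewrite (@ge0_integral_nat _ _ _ _ X setT (fun k => g k.+1)%R) //.
rewrite nneseries_recl//; last by move=> k _; rewrite mule_ge0 ?lee_fin.
rewrite mul0r mul0e add0e -nneseries_addn; last first.
  by move=> k; rewrite mule_ge0 ?lee_fin.
rewrite -nneseriesZl; last by move=> k _; rewrite mule_ge0 ?lee_fin.
apply: eq_eseriesr => k _; rewrite !setTI !poisson_preimage1 -!EFinM addn1.
congr EFin; rewrite factS natrM invfM exprS.
have : (k.+1%:R != 0 :> R)%R by rewrite pnatr_eq0.
have : (k`!%:R != 0 :> R)%R by rewrite pnatr_eq0 -lt0n fact_gt0.
by move: (k.+1%:R)%R (k`!%:R)%R => x y y0 x0; field; rewrite x0 y0.
Qed.

Lemma poisson_mean : \int[P]_w ((X w)%:R)%:E = lambda%:E.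
Proof.
have := @poisson_shift (cst 1%R) (fun=> ler01).
under eq_integral do rewrite mulr1.
move=> -> /=; rewrite -[X in _ = X]mule1; congr (_ * _).
exact: (integral_probability_cst P 1).
Qed.

Lemma poisson_sqr : \int[P]_w ((X w)%:R ^+ 2)%:E = (lambda + lambda ^+ 2)%:E.
Proof.
have := @poisson_shift (fun k => k%:R) (fun=> ler0n _ _).
under eq_integral do rewrite -expr2.
move=> ->; under eq_integral do rewrite -natr1 EFinD.
rewrite ge0_integralD //; last first.
  exact: (measurable_EFin_nat_comp X (fun k => k%:R)%R).
rewrite poisson_mean (integral_probability_cst P 1) -EFinD -EFinM.
by rewrite mulrDr mulr1 addrC expr2.
Qed.

Lemma poisson_ge1 : P (X @^-1` [set k | (1 <= k)%N]) = (1 - expR (- lambda))%:E.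
Proof.
have -> : X @^-1` [set k | (1 <= k)%N] = ~` (X @^-1` [set 0%N]).
  by apply/seteqP; split=> w /=; rewrite lt0n => /eqP.
rewrite probability_setC ?poisson_preimage1; last exact: measurable_preimage_nat.
by rewrite expr0 invr1 !mul1r EFinB.
Qed.

Lemma poisson_indic : \int[P]_w ((1 <= X w)%N%:R : R)%:E = (1 - expR (- lambda))%:E.
Proof.
rewrite -poisson_ge1 -[RHS]mul1e -integral_cst; last exact: measurable_preimage_nat.
rewrite [RHS]integral_mkcond; apply: eq_integral => w _ /=.
rewrite /patch; have [Xw|Xw] := boolP (1 <= X w)%N.
  by rewrite mem_set.
by rewrite memNset //; exact/negP.
Qed.
End poisson.

(** * Integration against a conditional probability *)

Section conditional.
Context (d : measure_display) (T : measurableType d) (R : realType)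
  (P : probability T R) (A : set T) (mA : measurable A).
Hypothesis PA0 : P A != 0.

(** The complement of [A] is null for the conditional probability, and on subsets of [A] this
    measure is [P] scaled by the inverse of [P A]. *)
Lemma ge0_integral_cond_prob (f : T -> \bar R) :
    measurable_fun [set: T] f -> (forall w, 0 <= f w) ->
  \int[cond_prob P mA]_w f w = (fine (P A))^-1%:E * \int[P]_(w in A) f w.
Proof.
move=> mf f0.
have c0 : (0 <= (fine (P A))^-1)%R by rewrite invr_ge0 fine_ge0.
rewrite -[in LHS](setUCr A) ge0_integral_setU //; last 3 first.
- exact: measurableC.
- by rewrite setUCr.
- by apply/disj_setPCl.
rewrite [X in _ + X]null_set_integral; last 3 first.
- exact: measurableC.
- exact: measurable_funTS.
- by rewrite [LHS](cond_probE mA) // setICl measure0 mul0e.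
rewrite adde0 (eq_measure_integral (mscale (NngNum c0) P)).
  by rewrite ge0_integral_mscale //; exact: measurable_funTS.
by move=> U mU UA; rewrite [LHS](cond_probE mA) // setIidl // muleC.
Qed.
End conditional.

(** Jensen's inequality for the uniform mean [m] over [A], obtained by expanding the nonnegative sum
    of [(x j - m) ^+ 2] over [A]. *)
Lemma sqr_mean_le (R : realFieldType) (I : finType) (x : I -> R) (A : {set I}) :
    (forall j, j \notin A -> x j = 0%R) ->
  (((\sum_j x j) / #|A|%:R) ^+ 2 <= (\sum_j x j ^+ 2) / #|A|%:R)%R.
Proof.
(* For empty [A] both quotients are divisions by zero, hence 0. *)
move=> xA; have [->|A0] := eqVneq A finset.set0.
  by rewrite cards0 invr0 !mulr0 expr0n.
have c0 : (0 < #|A|%:R :> R)%R by rewrite ltr0n card_gt0.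
set f := (\sum_j x j)%R; set s := (\sum_j x j ^+ 2)%R.
set m := (f / #|A|%:R)%R.
have fm : (f = m * #|A|%:R)%R by rewrite /m divfK ?gt_eqF.
have : (0 <= \sum_(j in A) (x j - m) ^+ 2)%R by apply: sumr_ge0 => j _; rewrite sqr_ge0.
have restrict (y : I -> R) : (forall j, j \notin A -> y j = 0%R) ->
    (\sum_(j in A) y j = \sum_j y j)%R.
  by move=> yA; rewrite [RHS](bigID (mem A)) /= [X in (_ + X)%R]big1 ?addr0.
under eq_bigr do rewrite sqrrB.
rewrite !big_split /= sumrN sumrMnl -mulr_suml (restrict x xA).
have -> : (\sum_(j in A) x j ^+ 2 = s)%R.
  by apply: (restrict (fun j => x j ^+ 2)%R) => j /xA ->; rewrite expr0n.
rewrite sumr_const -[(m ^+ 2 *+ _)%R]mulr_natl -/f -/s {1}fm => h.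
rewrite ler_pdivlMr // -subr_ge0; apply: le_trans h _.
by rewrite le_eqVlt; apply/orP; left; apply/eqP; rewrite mulr2n; ring.
Qed.

(** * Variance from second moments *)

Section second_moments.
Context (d : measure_display) (T : measurableType d) (R : realType)
  (P : probability T R).

Lemma Lfun2_sqr (f : T -> R) : measurable_fun [set: T] f ->
  \int[P]_w (f w ^+ 2)%:E < +oo -> f \in Lfun P 2%:E.
Proof.
move=> mf foo; rewrite inE; apply/andP; split; rewrite inE //=.
rewrite /finite_norm unlock /Lnorm poweR_lty //.
by under eq_integral do rewrite /= powR_mulrn // real_normK ?num_real //.
Qed.

Lemma variance_moments (f : T -> R) (a b : R) : measurable_fun [set: T] f ->
    \int[P]_w (f w)%:E = a%:E -> \int[P]_w (f w ^+ 2)%:E = b%:E ->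
  'V_P[f] = (b - a ^+ 2)%:E.
Proof.
move=> mf fa fb; rewrite varianceE; last by apply: Lfun2_sqr; rewrite // fb ltry.
by rewrite unlock fa EFinB; congr (_ - _).
Qed.

(** The variance is the second moment minus a squared mean; an infinite second moment makes the
    bound trivial. *)
Lemma variance_le_sqr (f : T -> R) : measurable_fun [set: T] f ->
  'V_P[f] <= \int[P]_w (f w ^+ 2)%:E.
Proof.
move=> mf; have [foo|] := ltP (\int[P]_w (f w ^+ 2)%:E) +oo; last first.
  by rewrite leye_eq => /eqP ->; rewrite leey.
have f2 := Lfun2_sqr mf foo.
have : 'E_P[f] \is a fin_num.
  by rewrite expectation_fin_num // Lfun_subset12 ?fin_num_measure.
rewrite varianceE // => /fineK <-; rewrite -EFin_expe.
have -> : 'E_P[(f ^+ 2)%R] = \int[P]_w (f w ^+ 2)%:E by rewrite unlock.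
by rewrite leeBlDr // leeDl // lee_fin sqr_ge0.
Qed.
End second_moments.

(** * Sums over independent windows: mean and variance *)

Section flow.
Context (d : measure_display) (T : measurableType d) (R : realType)
  (P : probability T R) (i : nat) (n : 'I_i -> {RV P >-> nat}).
Hypothesis n_indep : mutually_independent n.

Lemma indep_pair j k (U V : set nat) : j != k ->
  P (n j @^-1` U `&` n k @^-1` V) = P (n j @^-1` U) * P (n k @^-1` V).
Proof.
(* Only the values of [B] at [j] and [k] enter the intersection; elsewhere [V] is a filler. *)
move=> jk; pose B l := if l == j then U else V.
have := @n_indep [set j; k]%SET B (fun _ => I).
rewrite big_setU1 ?inE // big_set1 /B eqxx eq_sym (negbTE jk) => <-.
congr (P _); apply/seteqP; split => w /=.
  move=> [Uj Vk] l /=; rewrite !inE => /orP[] /eqP ->.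
    by rewrite /B eqxx.
  by rewrite /B eq_sym (negbTE jk).
move=> H; split.
  by have := H j; rewrite /= !inE eqxx /B => /(_ isT).
by have := H k; rewrite /= !inE eqxx orbT /B eq_sym (negbTE jk) => /(_ isT).
Qed.

Variables (g : nat -> R) (a : R).
Hypotheses (g0 : forall k, (0 <= g k)%R)
  (ga : forall j, \int[P]_w (g (n j w))%:E = a%:E).

Lemma measurable_sum_nat : measurable_fun [set: T] (fun w => \sum_(j < i) g (n j w))%R.
Proof. by apply: measurable_sum => j; exact: (measurable_nat_comp (n j) g). Qed.

Lemma integral_sum_iid :
  \int[P]_w (\sum_(j < i) g (n j w))%:E = (i%:R * a)%:E.
Proof.
under eq_integral do rewrite -sumEFin.
rewrite ge0_integral_sum //; last 2 first.
- by move=> j; exact: (measurable_EFin_nat_comp (n j) g).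
- by move=> j w _; rewrite lee_fin.
under eq_bigr do rewrite ga.
by rewrite sumEFin sumr_const card_ord mulr_natl.
Qed.

(** The square of the sum expands into a double sum whose [i] diagonal terms have mean [b] and whose
    [i * (i - 1)] other terms have mean [a ^+ 2] by pairwise independence. *)
Lemma variance_sum_iid (b : R) :
    (forall j, \int[P]_w (g (n j w) ^+ 2)%:E = b%:E) ->
  'V_P[fun w => (\sum_(j < i) g (n j w))%R] = (i%:R * (b - a ^+ 2))%:E.
Proof.
move=> gb; rewrite (variance_moments (b := (i%:R * a) ^+ 2 + i%:R * (b - a ^+ 2))
  measurable_sum_nat integral_sum_iid); first by rewrite addrAC subrr add0r.
under eq_integral => w _.
  rewrite expr2 big_distrlr /= -sumEFin.
  under eq_bigr do rewrite -sumEFin.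
  over.
have mgg j k : measurable_fun [set: T] (fun w => (g (n j w) * g (n k w))%:E).
  apply/measurable_EFinP; apply: measurable_funM.
    exact: (measurable_nat_comp (n j) g).
  exact: (measurable_nat_comp (n k) g).
have gg0 j k w : 0 <= (g (n j w) * g (n k w))%:E by rewrite lee_fin mulr_ge0.
rewrite ge0_integral_sum //=; last 2 first.
- by move=> j; apply: emeasurable_sum => k; exact: mgg.
- by move=> j w _; apply: sume_ge0.
have row j : \int[P]_w (\sum_(k < i) (g (n j w) * g (n k w))%:E) =
    (i%:R * a ^+ 2 + (b - a ^+ 2))%:E.
  rewrite ge0_integral_sum // (bigD1 j) //=.
  have -> : \int[P]_w (g (n j w) * g (n j w))%:E = b%:E.
    by under eq_integral do rewrite -expr2.
  rewrite (eq_bigr (fun=> (a ^+ 2)%:E)) => [|k kj].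
    rewrite sumEFin sumr_const cardC1 card_ord -EFinD; congr EFin.
    (* The index [j] witnesses [0 < i], so [i.-1] is a true predecessor. *)
    have -> : (a ^+ 2 *+ i.-1 = i%:R * a ^+ 2 - a ^+ 2)%R.
      by rewrite mulr_natl -{2}(prednK (leq_ltn_trans (leq0n j) (ltn_ord j))) mulrS addrAC subrr add0r.
    by ring.
  rewrite expr2; apply: ge0_integral_mul_indep => // m l.
  by apply: indep_pair; rewrite eq_sym.
rewrite (eq_bigr _ (fun j _ => row j)).
rewrite sumEFin sumr_const card_ord; congr EFin.
by rewrite -[LHS]mulr_natl; ring.
Qed.

(** * Decomposition by the set of active windows *)

Definition activity (w : T) : {set 'I_i} := finset (fun j => (1 <= n j w)%N).

Lemma persistenceE w : persistence n w = #|activity w|.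
Proof.
rewrite /persistence -sum1_card [RHS]big_mkcond.
by apply: eq_bigr => j _; rewrite inE; case: ifP.
Qed.

Definition pattern S : set T := [set w | activity w = S].

(** This gives one constraint per window, the form to which mutual independence applies. *)
Lemma patternE S : pattern S =
  \bigcap_(j in [set` [set: 'I_i]%SET]) n j @^-1` [set k | (1 <= k)%N = (j \in S)].
Proof.
apply/seteqP; split=> w /=.
  by move=> <- j _ /=; rewrite inE.
by move=> H; apply/setP => j; rewrite inE; apply: (H j); rewrite /= inE.
Qed.

Lemma measurable_pattern S : measurable (pattern S).
Proof.
rewrite patternE; apply: fin_bigcap_measurable => // j _.
exact: measurable_preimage_nat.
Qed.

(** Persistence is the cardinality of the activity, so [active n] is the finite disjoint union of
    the patterns with nonempty [S]. *)
Lemma integral_active (f : T -> \bar R) : measurable_fun [set: T] f ->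
    (forall w, 0 <= f w) ->
  \int[P]_(w in active n) f w =
  \sum_(S | S != finset.set0) \int[P]_(w in pattern S) f w.
Proof.
move=> mf f0; rewrite -big_filter -ge0_integral_bigsetU //.
- rewrite -bigcup_seq; congr (integral _ _ _); apply/seteqP; split=> w /=.
    rewrite /active /= persistenceE card_gt0 => w0; exists (activity w) => //=.
    by rewrite mem_filter w0 mem_index_enum.
  move=> [S /= + Sw]; rewrite mem_filter => /andP[S0 _].
  by rewrite /active /= persistenceE card_gt0 Sw.
- exact: measurable_pattern.
- by rewrite filter_uniq // index_enum_uniq.
- apply/trivIsetP => S S' _ _ SS'; apply/seteqP; split=> // w [/= wS wS'].
  by move: SS'; rewrite -wS wS' eqxx.
- exact: measurable_funTS.
Qed.

Variables (q : R).
Hypotheses (q0 : (0 < q)%R)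
 (nq : forall j, P (n j @^-1` [set k | (1 <= k)%N]) = q%:E).
Hypothesis g_0 : g 0%N = 0%R.

(** By independence the windows other than [j] contribute a common factor [c]. Window [j]
    contributes [a] to the integral, because [g 0 = 0] makes the restriction to positive counts
    harmless, and [q] to the probability; hence the ratio [a / q]. *)
Lemma integral_pattern (S : {set 'I_i}) (j : 'I_i) : j \in S ->
  \int[P]_(w in pattern S) (g (n j w))%:E = (a / q)%:E * P (pattern S).
Proof.
move=> jS.
pose B l := [set k | (1 <= k)%N = (l \in S)].
pose c := \prod_(l in [set~ j]%SET) P (n l @^-1` B l).
have H U : P (pattern S `&` n j @^-1` U) =
    P (n j @^-1` ([set k | (1 <= k)%N] `&` U)) * c.
  (* Since [j] lies in [S], the pattern already forces a positive count in window [j]; [B'] adds the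
     constraint [U] there. *)
  pose B' l := if l == j then [set k | (1 <= k)%N] `&` U else B l.
  have := @n_indep [set: 'I_i]%SET B' (fun _ => I).
  rewrite (bigD1 j) ?inE //= {2}/B' eqxx => E.
  rewrite /c (eq_bigr (fun l => P (n l @^-1` B' l))); last first.
    by move=> l; rewrite !inE /B' => /negbTE ->.
  rewrite (eq_bigl (fun l => (l \in [set: 'I_i]%SET) && (l != j))); last first.
    by move=> l; rewrite !inE.
  rewrite -E patternE; congr (P _); apply/seteqP; split=> w /=.
    move=> [Sw Uw] l /= _; rewrite /B'; case: eqVneq => [->|_].
      by split=> //; have := Sw j; rewrite /= inE jS; apply.
    by apply: Sw; rewrite /= inE.
  move=> Bw; split; last first.
    by have := Bw j; rewrite /B' eqxx /= inE => /(_ isT) [].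
  move=> l _; have := Bw l; rewrite /B' /= inE => /(_ isT).
  by case: eqVneq => [-> [->]|].
have c0 : c \is a fin_num.
  rewrite /c; elim/big_ind: _ => // [x y|l _]; first exact: fin_numM.
  by rewrite fin_num_measure //; exact: measurable_preimage_nat.
have -> : P (pattern S) = q%:E * c.
  by rewrite -(setIT (pattern S)) -(preimage_setT (n j)) H setIT nq.
rewrite muleA -EFinM divfK ?gt_eqF // muleC -(ga j).
rewrite ge0_integral_nat //; last exact: measurable_pattern.
rewrite ge0_integral_nat // -(fineK c0) -nneseriesZl; last first.
  by move=> k _; rewrite mule_ge0 ?lee_fin.
apply: eq_eseriesr => k _; rewrite muleCA H fineK // setTI.
(* The term at 0 vanishes by [g_0]; at a successor the positivity constraint is automatic. *)
case: k => [|k]; first by rewrite g_0 !mul0e.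
congr (_ * _); rewrite muleC; congr (_ * P _).
by apply/seteqP; split=> w /= => [[]|->].
Qed.

Lemma measurable_ratio : measurable_fun [set: T]
  (fun w => (\sum_(j < i) g (n j w)) / (persistence n w)%:R)%R.
Proof.
apply: measurable_funM; first exact: measurable_sum_nat.
apply: (@measurableT_comp _ _ _ _ _ _ (fun m : nat => (m%:R : R)^-1)%R _
  (persistence n)) => // _ U mU; rewrite setTI.
(* Measurability of the persistence: a preimage is a finite union of patterns, selected by the
   cardinality of [S]. *)
rewrite (_ : _ @^-1` U = \bigcup_(S in [set S : {set 'I_i} | U #|S|]) pattern S).
  by apply: fin_bigcup_measurable => // S _; exact: measurable_pattern.
apply/seteqP; split=> w /=; rewrite persistenceE; first by exists (activity w).
by move=> [S US wS]; rewrite wS.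
Qed.

(** On each pattern the denominator is the constant [#|S|], and the ratio averages [#|S|] terms with
    the same integral; the result is proportional to [P (pattern S)] with a factor independent of
    [S]. *)
Lemma integral_active_ratio :
  \int[P]_(w in active n) ((\sum_(j < i) g (n j w)) / (persistence n w)%:R)%:E
  = (a / q)%:E * P (active n).
Proof.
have -> : P (active n) = \sum_(S | S != finset.set0) P (pattern S).
  rewrite -[LHS]mul1e -integral_cst; last exact: measurable_active.
  rewrite integral_active //; apply: eq_bigr => S _.
  by rewrite integral_cst ?mul1e //; exact: measurable_pattern.
rewrite integral_active; last 2 first.
- by apply/measurable_EFinP; exact: measurable_ratio.
- by move=> w; rewrite lee_fin divr_ge0 // sumr_ge0.
rewrite ge0_sume_distrr //; apply: eq_bigr => S S0.
transitivity (\int[P]_(w in pattern S)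
    \sum_(j in S) ((#|S|%:R^-1)%:E * (g (n j w))%:E)).
  apply: eq_integral => w /[!inE] /= wS.
  rewrite -ge0_sume_distrr; last by move=> j _; rewrite lee_fin.
  (* Windows outside [S] have count 0 and contribute [g 0 = 0]. *)
  rewrite sumEFin -EFinM mulrC persistenceE wS; congr (_ * _)%:E.
  rewrite (bigID (mem S)) /= addrC big1 ?add0r // => j.
  by rewrite -wS inE lt0n negbK => /eqP ->.
under eq_integral do rewrite -big_enum.
rewrite ge0_integral_sum /=; last 3 first.
- exact: measurable_pattern.
- by move=> j; apply: measurable_funeM; exact: (measurable_EFin_nat_comp (n j) g).
- by move=> j w _; rewrite mule_ge0 // lee_fin.
rewrite big_enum /=.
transitivity (\sum_(j in S) ((#|S|%:R^-1)%:E * ((a / q)%:E * P (pattern S)))).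
  apply: eq_bigr => j jS; rewrite -(integral_pattern jS) ge0_integralZl //.
  - exact: measurable_pattern.
  - exact: (measurable_EFin_nat_comp (n j) g).
  - by move=> w _; rewrite lee_fin.
rewrite -(@fineK _ (P (pattern S))); last first.
  by rewrite fin_num_measure //; exact: measurable_pattern.
rewrite -!EFinM sumEFin sumr_const -[X in X%:E = _]mulr_natl mulrA mulfV ?mul1r //.
by rewrite pnatr_eq0 cards_eq0.
Qed.
End flow.

(** * Means and variances of frequency, persistence and density *)

Theorem theorem5p1 (d : measure_display) (T : measurableType d) (R : realType)
    (P : probability T R) (lambda : R) (i : nat) (n : 'I_i -> {RV P >-> nat})
    (lambda_gt0 : (0 < lambda)%R) (i_ge1 : (1 <= i)%N)
    (n_indep : mutually_independent n)
    (n_poisson : forall j, poisson_distributed lambda (n j)) :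
  'E_P[fun w => (frequency n w)%:R] = (i%:R * lambda)%:E /\
  'E_P[fun w => (persistence n w)%:R] = (i%:R * (1 - expR (- lambda)))%:E /\
  'E_(cond_active n)[density n] = (lambda / (1 - expR (- lambda)))%:E /\
  'V_P[fun w => (frequency n w)%:R] = (i%:R * lambda)%:E /\
  'V_P[fun w => (persistence n w)%:R]
    = (i%:R * expR (- lambda) * (1 - expR (- lambda)))%:E /\
  'V_(cond_active n)[density n]
    <= (lambda ^+ 2 / (1 - expR (- lambda)) ^+ 2
        + (lambda + lambda ^+ 2) / (1 - expR (- lambda)))%:E < +oo.
Proof.
pose q := (1 - expR (- lambda))%R.
have q0 : (0 < q)%R by rewrite subr_gt0 expR_lt1 oppr_lt0.
have m1 j := poisson_mean lambda_gt0 (n_poisson j).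
have m2 j := poisson_sqr lambda_gt0 (n_poisson j).
have nq j := poisson_ge1 lambda_gt0 (n_poisson j).
have mq j := poisson_indic lambda_gt0 (n_poisson j).
have nat0 k : (0 <= k%:R :> R)%R by [].
have fE : (fun w => (frequency n w)%:R) = (fun w => \sum_(j < i) (n j w)%:R)%R :> (T -> R).
  by apply/funext => w; rewrite /frequency natr_sum.
have pE : (fun w => (persistence n w)%:R) =
    (fun w => \sum_(j < i) (1 <= n j w)%N%:R)%R :> (T -> R).
  by apply/funext => w; rewrite /persistence natr_sum.
(* Some window exists as [i] is positive, and its being active has probability [q > 0]; the
   conditioning is therefore genuine. *)
have PA0 : P (active n) != 0.
  pose j := Ordinal i_ge1.
  rewrite gt_eqF //; apply: (@lt_le_trans _ _ (q%:E)); first by rewrite lte_fin.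
  rewrite /q -(nq j); apply: le_measure; rewrite ?inE.
  - exact: measurable_preimage_nat.
  - exact: measurable_active.
  move=> w /= nj; rewrite /active /= lt0n sum_nat_eq0; apply/forallPn.
  by exists j; rewrite /= nj.
(* The normalisation of the conditional probability cancels the factor [P (active n)] produced by
   [integral_active_ratio]. *)
have cancelPA (x : R) : ((fine (P (active n)))^-1)%:E * (x%:E * P (active n)) = x%:E.
  have Pfin : P (active n) \is a fin_num.
    by rewrite fin_num_measure //; exact: measurable_active.
  rewrite -{2}(fineK Pfin) -!EFinM mulrCA mulVf ?mulr1 //.
  by rewrite fine_eq0.
have dE w : density n w = ((\sum_(j < i) (n j w)%:R) / (persistence n w)%:R)%R.
  by rewrite /density /frequency natr_sum.
have md : measurable_fun [set: T] (density n).
  rewrite (funext dE).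
  exact: (measurable_ratio n (fun k => k%:R)%R).
have d0 w : (0 <= density n w)%R by rewrite dE divr_ge0 // sumr_ge0.
split; first by rewrite fE unlock; exact: (integral_sum_iid nat0 m1).
split.
  rewrite pE unlock.
  exact: (integral_sum_iid (g := fun k => (1 <= k)%N%:R%R) (fun=> nat0 _) mq).
split.
  rewrite unlock (ge0_integral_cond_prob _ PA0) //; last first.
    exact/measurable_EFinP.
  under eq_integral do rewrite dE.
  by rewrite (integral_active_ratio n_indep nat0 m1 q0 nq erefl) cancelPA.
split.
  rewrite fE (variance_sum_iid n_indep nat0 m1 m2); congr EFin; ring.
split.
  (* An indicator equals its square, so both moments are [q], and [q - q ^+ 2] is
     [expR (- lambda) * q]. *)
  rewrite pE (variance_sum_iid (g := fun k => (1 <= k)%N%:R%R) (b := q) n_indep (fun=> nat0 _) mq).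
    by congr EFin; rewrite /q; ring.
  move=> j; rewrite -[RHS](mq j); apply: eq_integral => w _.
  by rewrite -natrX; case: (1 <= n j w)%N.
rewrite ltry andbT (le_trans (variance_le_sqr _ md)) //.
rewrite (ge0_integral_cond_prob _ PA0) //; last 2 first.
- by apply/measurable_EFinP; exact: measurable_funX.
- by move=> w; rewrite lee_fin sqr_ge0.
(* The second moment is bounded by the second summand of the claim; the first summand is
   nonnegative. *)
apply: (@le_trans _ _ ((lambda + lambda ^+ 2) / q)%:E); last first.
  by rewrite lee_fin lerDr divr_ge0 // sqr_ge0.
have ms := measurable_ratio n (fun k => k%:R ^+ 2 : R)%R.
have sq0 k : (0 <= k%:R ^+ 2 :> R)%R by rewrite sqr_ge0.
(* With [g] the square, this bound is exactly the conditional mean of the average of the squared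
   counts over the active windows, which dominates the squared density pointwise. *)
rewrite -[leRHS]cancelPA -(integral_active_ratio n_indep sq0 m2 q0 nq); last by rewrite expr0n.
apply: lee_wpmul2l; first by rewrite lee_fin invr_ge0 fine_ge0.
apply: ge0_le_integral => //.
- exact: measurable_active.
- by move=> w _; rewrite lee_fin sqr_ge0.
- by apply/measurable_EFinP; apply: measurable_funTS; exact: measurable_funX.
- by apply/measurable_EFinP; apply: measurable_funTS.
move=> w _; rewrite lee_fin dE persistenceE.
apply: (@sqr_mean_le R _ (fun j => (n j w)%:R) (activity n w)) => j.
by rewrite inE lt0n negbK => /eqP ->.
Qed.
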